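(* Let $\mathcal{T}$ be a Krull-Schmidt triangulated category with a silting subcategory $\mathcal{M}$. Then the Grothendieck group $K_0(\mathcal{T})$ of the triangulated category $\mathcal{T}$ is a free abelian group with a basis given by (the classes of) $\mathrm{ind}\,\mathcal{M}$, the set of isomorphism classes of indecomposable objects in $\mathcal{M}$.
   Context: A ''subcategory'' of $\mathcal{T}$ always means a full subcategory closed under isomorphisms, finite coproducts and direct summands. A subcategory $\mathcal{M}$ of $\mathcal{T}$ is silting if $\mathrm{Hom}_{\mathcal{T}}(M,M'[i])=0$ for all $M,M'\in\mathcal{M}$ and $i>0$, and $\mathcal{T}=\mathrm{thick}\,\mathcal{M}$, where $\mathrm{thick}\,\mathcal{M}$ is the smallest thick subcategory containing $\mathcal{M}$. $\mathcal{T}$ is Krull-Schmidt if any object is isomorphic to a finite coproduct of objects whose endomorphism rings are local. *)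

(* Defs.v *)
From HB Require Import structures.
From mathcomp Require Import all_boot all_algebra all_classical.
From mathcomp.multinomials Require Import freeg.

Set Implicit Arguments.
Unset Strict Implicit.
Unset Printing Implicit Defensive.

Import GRing.Theory.
Local Open Scope classical_set_scope.
Local Open Scope quotient_scope.
Local Open Scope ring_scope.

Declare Scope cat_scope.
Delimit Scope cat_scope with cat.
Local Open Scope cat_scope.

(** * Additive categories *)

Record preadditiveCat := PreadditiveCat {
  obj :> Type;
  hom : obj -> obj -> zmodType;
  idm : forall X, hom X X;
  comp : forall X Y Z, hom Y Z -> hom X Y -> hom X Z;
  compA : forall X Y Z W (h : hom Z W) (g : hom Y Z) (f : hom X Y),
    comp h (comp g f) = comp (comp h g) f;
  comp1m : forall X Y (f : hom X Y), comp (idm Y) f = f;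
  compm1 : forall X Y (f : hom X Y), comp f (idm X) = f;
  compDl : forall X Y Z (g g' : hom Y Z) (f : hom X Y),
    comp (g + g') f = comp g f + comp g' f;
  compDr : forall X Y Z (g : hom Y Z) (f f' : hom X Y),
    comp g (f + f') = comp g f + comp g f' }.

Arguments hom {p}.
Arguments idm {p} X.
Arguments comp {p X Y Z}.

Notation "g '@;' f" := (comp g f) (at level 40, left associativity) : cat_scope.

Section PreadditiveTheory.
Variable C : preadditiveCat.
Implicit Types X Y Z : C.

Definition is_iso X Y (f : hom X Y) : Prop :=
  exists g : hom Y X, g @; f = idm X /\ f @; g = idm Y.

Definition isomorphic X Y : Prop := exists f : hom X Y, is_iso f.

Definition is_zero X : Prop :=
  forall Y, (forall f : hom X Y, f = 0) /\ (forall f : hom Y X, f = 0).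

Definition is_coproduct (I : Type) (X : I -> C) S (i : forall k, hom (X k) S) : Prop :=
  forall Y (f : forall k, hom (X k) Y),
    exists! g : hom S Y, forall k, g @; i k = f k.

Definition coproduct_of (I : Type) (X : I -> C) S : Prop :=
  exists i : forall k, hom (X k) S, is_coproduct i.

Definition coproduct2_of X Y S : Prop :=
  coproduct_of (fun b : bool => if b then X else Y) S.

Definition direct_summand X S : Prop := exists Y, coproduct2_of X Y S.

Definition indecomposable X : Prop :=
  ~ is_zero X /\ forall Y Z, coproduct2_of Y Z X -> is_zero Y \/ is_zero Z.

(** The endomorphism ring; as a type it is just [hom X X]. *)
Definition End X : Type := hom X X.

HB.instance Definition _ X := GRing.Zmodule.on (End X).

Definition End_mul X (f g : End X) : End X := f @; g.

Lemma End_mulA X : associative (@End_mul X).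
Proof. by move=> f g h; apply: compA. Qed.

Lemma End_mul1 X : left_id (idm X : End X) (@End_mul X).
Proof. by move=> f; apply: comp1m. Qed.

Lemma End_mulr1 X : right_id (idm X : End X) (@End_mul X).
Proof. by move=> f; apply: compm1. Qed.

Lemma End_mulDl X : left_distributive (@End_mul X) +%R.
Proof. by move=> f g h; apply: compDl. Qed.

Lemma End_mulDr X : right_distributive (@End_mul X) +%R.
Proof. by move=> f g h; apply: compDr. Qed.

HB.instance Definition _ X := GRing.Zmodule_isPzRing.Build (End X)
  (@End_mulA X) (@End_mul1 X) (@End_mulr1 X) (@End_mulDl X) (@End_mulDr X).

(** Isomorphism classes of objects. *)
Definition isob : rel {classic C} := fun X Y => `[< isomorphic X Y >].

Lemma isob_refl : reflexive isob.
Proof.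
by move=> X; apply/asboolP; exists (idm X), (idm X); rewrite comp1m.
Qed.

Lemma isob_sym : symmetric isob.
Proof.
by move=> X Y; apply/asboolP/asboolP => -[f [g [gf fg]]]; exists g, f.
Qed.

Lemma isob_trans : transitive isob.
Proof.
move=> Y X Z /asboolP[f [f' [f'f ff']]] /asboolP[g [g' [g'g gg']]].
apply/asboolP; exists (g @; f), (f' @; g'); split.
  by rewrite compA -(compA f') g'g compm1.
by rewrite compA -(compA g) ff' compm1.
Qed.

Canonical iso_equiv := EquivRel isob isob_refl isob_sym isob_trans.

Definition isoclass := {eq_quot iso_equiv}.

HB.instance Definition _ := Choice.on isoclass.

Definition iso_class X : isoclass := \pi_isoclass (X : {classic C}).

End PreadditiveTheory.

Arguments iso_class {C} X.

(** A preadditive category with finite coproducts is additive: they are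
    automatically biproducts, and the empty one is a zero object. *)
Record additiveCat := AdditiveCat {
  preadditive_of :> preadditiveCat;
  has_coproducts : forall n (X : 'I_n -> preadditive_of),
    exists S, coproduct_of X S }.

Record additiveFunctor (C D : preadditiveCat) := AdditiveFunctor {
  fobj :> C -> D;
  fmap : forall X Y : C, hom X Y -> hom (fobj X) (fobj Y);
  fmap1 : forall X, fmap (idm X) = idm (fobj X);
  fmap_comp : forall X Y Z (g : hom Y Z) (f : hom X Y),
    fmap (g @; f) = fmap g @; fmap f;
  fmapD : forall X Y (f g : hom X Y), fmap (f + g) = fmap f + fmap g }.

Arguments fmap {C D} a {X Y}.

(** [G \o F] is naturally isomorphic to the identity functor. *)
Definition left_quasi_inverse (C D : preadditiveCat)
    (F : additiveFunctor C D) (G : additiveFunctor D C) : Prop :=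
  exists e : forall X, hom (G (F X)) X,
    (forall X, is_iso (e X)) /\
    (forall X Y (f : hom X Y), f @; e X = e Y @; fmap G (fmap F f)).

(** * Triangulated categories

    The shift is an autoequivalence (with chosen quasi-inverse) rather than a
    strict automorphism.  [dist f g h] states that
    X --f--> Y --g--> Z --h--> X[1] is a distinguished triangle. *)
Record triangulatedCat := TriangulatedCat {
  additive_of :> additiveCat;
  shift : additiveFunctor additive_of additive_of;
  unshift : additiveFunctor additive_of additive_of;
  shiftK : left_quasi_inverse shift unshift;
  unshiftK : left_quasi_inverse unshift shift;
  dist : forall X Y Z : additive_of,
    hom X Y -> hom Y Z -> hom Z (shift X) -> Prop;
  dist_iso : forall X Y Z X' Y' Z'
      (f : hom X Y) (g : hom Y Z) (h : hom Z (shift X))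
      (f' : hom X' Y') (g' : hom Y' Z') (h' : hom Z' (shift X'))
      (a : hom X X') (b : hom Y Y') (c : hom Z Z'),
    is_iso a -> is_iso b -> is_iso c ->
    b @; f = f' @; a -> c @; g = g' @; b -> fmap shift a @; h = h' @; c ->
    dist f g h -> dist f' g' h';
  dist_id : forall X O, is_zero O ->
    dist (idm X) (0 : hom X O) (0 : hom O (shift X));
  dist_ex : forall X Y (f : hom X Y),
    exists Z (g : hom Y Z) (h : hom Z (shift X)), dist f g h;
  dist_rot : forall X Y Z (f : hom X Y) (g : hom Y Z) (h : hom Z (shift X)),
    dist f g h <-> dist g h (- fmap shift f);
  dist_morph : forall X Y Z X' Y' Z'
      (f : hom X Y) (g : hom Y Z) (h : hom Z (shift X))
      (f' : hom X' Y') (g' : hom Y' Z') (h' : hom Z' (shift X'))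
      (a : hom X X') (b : hom Y Y'),
    dist f g h -> dist f' g' h' -> b @; f = f' @; a ->
    exists c : hom Z Z', c @; g = g' @; b /\ fmap shift a @; h = h' @; c;
  (* octahedral axiom; Z', X', Y' are cones of f, g and g @; f *)
  dist_octa : forall X Y Z X' Y' Z' (f : hom X Y) (g : hom Y Z)
      (i : hom Y Z') (j : hom Z' (shift X))
      (k : hom Z X') (l : hom X' (shift Y))
      (m : hom Z Y') (n : hom Y' (shift X)),
    dist f i j -> dist g k l -> dist (g @; f) m n ->
    exists (u : hom Z' Y') (v : hom Y' X'),
      [/\ dist u v (fmap shift i @; l),
          u @; i = m @; g /\ n @; u = j
        & v @; m = k /\ l @; v = fmap shift f @; n] }.

(** * Krull-Schmidt categories *)

Definition is_unit (R : pzRingType) (x : R) : Prop :=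
  exists y : R, y * x = 1 /\ x * y = 1.

Definition local_ring (R : pzRingType) : Prop :=
  (1 : R) <> 0 /\
  forall x y : R, ~ is_unit x -> ~ is_unit y -> ~ is_unit (x + y).

Definition krull_schmidt (C : preadditiveCat) : Prop :=
  forall S : C, exists n (X : 'I_n -> C),
    (forall k, local_ring (End (X k))) /\ coproduct_of X S.

(** * Subcategories

    A full subcategory is given by its set of objects. *)

Record is_subcategory (C : preadditiveCat) (M : set C) : Prop := IsSubcategory {
  sub_iso : forall X Y, isomorphic X Y -> M X -> M Y;
  sub_coproduct : forall n (X : 'I_n -> C) S,
    (forall k, M (X k)) -> coproduct_of X S -> M S;
  sub_summand : forall X S, direct_summand X S -> M S -> M X }.

Definition ind (C : preadditiveCat) (M : set C) : set (isoclass C) :=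
  [set iso_class X | X in [set X | M X /\ indecomposable X]].

Section Triangulated.
Variable T : triangulatedCat.

Record is_thick (S : set T) : Prop := IsThick {
  thick_sub : is_subcategory S;
  thick_shift : forall X, S X -> S (shift T X);
  thick_unshift : forall X, S X -> S (unshift T X);
  thick_cone : forall (X Y Z : T) (f : hom X Y) (g : hom Y Z) (h : hom Z (shift T X)),
    dist f g h -> S X -> S Y -> S Z }.

Definition thick (M : set T) : set T :=
  \bigcap_(S in [set S | is_thick S /\ M `<=` S]) S.

Record silting (M : set T) : Prop := Silting {
  silting_sub : is_subcategory M;
  silting_hom : forall (X Y : T) (i : nat), M X -> M Y -> (0 < i)%N ->
    forall f : hom X (iter i (shift T) Y), f = 0;
  silting_thick : thick M = setT }.

(** * The Grothendieck group

    The free abelian group on isomorphism classes of objects, modulo the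
    subgroup generated by the elements [Y] - [X] - [Z] for all distinguished
    triangles X -> Y -> Z -> X[1]. *)

Definition K0_gen : set {freeg isoclass T} :=
  [set D | exists (X Y Z : T) (f : hom X Y) (g : hom Y Z) (h : hom Z (shift T X)),
     dist f g h /\
     D = << iso_class Y >> - << iso_class X >> - << iso_class Z >>].

Definition K0_rel : {pred {freeg isoclass T}} :=
  fun D => `[< forall S : {pred {freeg isoclass T}}, zmod_closed S ->
                 (forall E, K0_gen E -> E \in S) -> D \in S >].

Lemma K0_rel_zmod_closed : zmod_closed K0_rel.
Proof.
split; first by apply/asboolP => S [].
move=> D E /asboolP HD /asboolP HE; apply/asboolP => S HS genS.
by have [_ ->] := HS; [|apply: HD|apply: HE].
Qed.

HB.instance Definition _ := GRing.isZmodClosed.Build _ K0_rel K0_rel_zmod_closed.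

Definition K0 : zmodType := Quotient.quot K0_rel.

Definition K0_class (c : isoclass T) : K0 := \pi_K0 << c >>.

End Triangulated.

(** The family [b] is a basis of [V]: every element is a unique (finite)
    integral linear combination of the [b i]. *)
Definition zbasis (I : choiceType) (V : zmodType) (b : I -> V) : Prop :=
  forall v, exists! D : {freeg I}, v = \sum_(i <- dom D) b i *~ coeff i D.

(* Main.v *)
From HB Require Import structures.
From mathcomp Require Import all_boot all_algebra all_classical.
From mathcomp.multinomials Require Import freeg.
Require Import Defs.

(** Write [X[k]] for the [k]-fold shift and [[N]] for the class of an object [N]
    of [M] in the split Grothendieck group of [M], which is free on [ind M] by the
    Krull-Remak-Schmidt-Azumaya theorem ([decomposes_uniq]).  The theorem says that
    this group maps isomorphically onto the Grothendieck group of [T], and the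
    proof builds the inverse, an Euler characteristic.

    Call an object filtered from level [k] if it is an iterated extension
    [N_k[k] * N_(k+1)[k+1] * ... * N_(k+l)[k+l]] with all [N_i] in [M] and the
    lowest shift as the first subobject ([filtered]).  Its Euler characteristic is
    the alternating sum of the [[N_i]].  Since [hom N N'[i]] vanishes for [i > 0],
    such filtrations behave like projective resolutions.
    - By the horseshoe lemma ([triangle_horseshoe]), filtered objects are closed
      under extensions, and the Euler characteristic is additive
      ([filtered_triangle]).
    - By Schanuel's lemma ([triangle_schanuel]) and induction on the length, the
      Euler characteristic does not depend on the filtration ([filtered_uniq]).
    - A stable comparison of approximations ([triangle_summand]) shows that
      filtered objects are closed under direct summands ([filtered_summand]).
    Besides that vanishing, all three rest on the octahedral axiom and on the
    splitting of triangles with zero connecting morphism.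

    Hence the objects [X] with some [X[n]] filtered from level [0] form a thick
    subcategory containing [M], so they are all the objects of [T]
    ([euler_thick], [euler_ex]), and [X] has a well-defined Euler characteristic,
    that of [X[n]] multiplied by [(-1)^n].  Being additive on triangles, it
    descends to the Grothendieck group, and it sends the class of an
    indecomposable [N] of [M] to [[N]]; this gives the linear independence
    ([ind_emb_pi_inj]).  Conversely the filtrations express every class as a
    combination of the classes of objects of [M], and these decompose into
    indecomposables ([ind_span_full]). *)

Set Implicit Arguments.
Unset Strict Implicit.
Unset Printing Implicit Defensive.

Import GRing.Theory.
Local Open Scope quotient_scope.
Local Open Scope ring_scope.
Local Open Scope cat_scope.

(** * Biproducts in preadditive categories *)

Section PreadditiveAlgebra.
Variable C : preadditiveCat.
Implicit Types X Y Z W S L : C.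

Lemma comp0m X Y Z (f : hom X Y) : (0 : hom Y Z) @; f = 0.
Proof. by apply: (addIr (0 @; f)); rewrite -compDl addr0 add0r. Qed.

Lemma compm0 X Y Z (g : hom Y Z) : g @; (0 : hom X Y) = 0.
Proof. by apply: (addIr (g @; 0)); rewrite -compDr addr0 add0r. Qed.

Lemma compNm X Y Z (g : hom Y Z) (f : hom X Y) : (- g) @; f = - (g @; f).
Proof. by apply: (addIr (g @; f)); rewrite -compDl !addNr comp0m. Qed.

Lemma compmN X Y Z (g : hom Y Z) (f : hom X Y) : g @; (- f) = - (g @; f).
Proof. by apply: (addIr (g @; f)); rewrite -compDr !addNr compm0. Qed.

Lemma compBl X Y Z (g g' : hom Y Z) (f : hom X Y) :
  (g - g') @; f = g @; f - g' @; f.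
Proof. by rewrite compDl compNm. Qed.

Lemma compBr X Y Z (g : hom Y Z) (f f' : hom X Y) :
  g @; (f - f') = g @; f - g @; f'.
Proof. by rewrite compDr compmN. Qed.

(** Rewriting rule for the inner factor of a left-associated composite. *)
Lemma comp_eqr X Y Z W (g : hom Y Z) (f : hom X Y) (e : hom X Z) :
  g @; f = e -> forall h : hom Z W, h @; g @; f = h @; e.
Proof. by move=> <- h; rewrite compA. Qed.

Lemma is_iso_id X : is_iso (idm X).
Proof. by exists (idm X); rewrite comp1m. Qed.

Lemma isomorphic_refl X : isomorphic X X.
Proof. by exists (idm X); apply: is_iso_id. Qed.

Lemma isomorphic_sym X Y : isomorphic X Y -> isomorphic Y X.
Proof. by case=> f [g [gf fg]]; exists g, f. Qed.

Lemma isomorphic_trans X Y Z :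
  isomorphic X Y -> isomorphic Y Z -> isomorphic X Z.
Proof. by move=> /asboolP XY /asboolP YZ; apply/asboolP/(isob_trans XY YZ). Qed.

Lemma iso_classP X Y : iso_class X = iso_class Y <-> isomorphic X Y.
Proof.
split=> [XY|XY]; first by apply/asboolP; apply/(@eqmodP _ (iso_equiv C)).
by apply/(@eqmodP _ (iso_equiv C)); apply/asboolP.
Qed.

Lemma is_zero_idP X : is_zero X <-> idm X = 0.
Proof.
split=> [/(_ X)[]//|id0 Y]; split=> f.
  by rewrite -(compm1 f) id0 compm0.
by rewrite -(comp1m f) id0 comp0m.
Qed.

Lemma is_zero_hom X Y (f : hom X Y) : is_zero X \/ is_zero Y -> f = 0.
Proof. by case=> [/(_ Y)[]|/(_ X)[]]. Qed.

Lemma is_zero_isomorphic X Y : is_zero X -> is_zero Y -> isomorphic X Y.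
Proof.
move=> X0 Y0; exists 0, 0; rewrite !comp0m.
by split; apply/esym/is_zero_idP.
Qed.

Lemma is_zero_iso X Y : isomorphic X Y -> is_zero X -> is_zero Y.
Proof.
move=> [f [g [gf fg]]] X0; apply/is_zero_idP.
by rewrite -fg (is_zero_hom f) ?comp0m //; left.
Qed.

(** Biproducts, in the equational form which every additive functor preserves:
    [i1], [i2] are the injections and [p1], [p2] the projections. *)
Definition is_biproduct X Y S (i1 : hom X S) (i2 : hom Y S)
    (p1 : hom S X) (p2 : hom S Y) : Prop :=
  [/\ p1 @; i1 = idm X, p2 @; i2 = idm Y, p1 @; i2 = 0, p2 @; i1 = 0
    & i1 @; p1 + i2 @; p2 = idm S].

Definition biproduct X Y S : Prop :=
  exists i1 i2 p1 p2, @is_biproduct X Y S i1 i2 p1 p2.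

Lemma is_biproduct_coproduct X Y S (i : forall b : bool, hom (if b then X else Y) S) :
  is_coproduct i -> exists p1 p2, is_biproduct (i true) (i false) p1 p2.
Proof.
move=> iP.
pose sel Z (f1 : hom X Z) (f2 : hom Y Z) (b : bool) :=
  if b return hom (if b then X else Y) Z then f1 else f2.
have [p1 [/= p1i _]] := iP _ (sel _ (idm X) 0).
have [p2 [/= p2i _]] := iP _ (sel _ 0 (idm Y)).
exists p1, p2.
have [p1i1 p1i2] := (p1i true, p1i false).
have [p2i1 p2i2] := (p2i true, p2i false).
split=> //.
have [g [_ gU]] := iP _ i.
rewrite -(gU (idm S)); last by move=> k; rewrite comp1m.
apply/esym/gU => -[]; rewrite compDl -!compA.
  by rewrite p1i1 p2i1 compm0 addr0 compm1.
by rewrite p1i2 p2i2 compm0 add0r compm1.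
Qed.

Lemma biproduct_coproduct2 X Y S : coproduct2_of X Y S <-> biproduct X Y S.
Proof.
split=> [[i /is_biproduct_coproduct[p1 [p2 ?]]]|].
  by exists (i true), (i false), p1, p2.
move=> [i1 [i2 [p1 [p2 [p11 p22 p12 p21 sum1]]]]].
exists (fun b => if b return hom (if b then X else Y) S then i1 else i2) => Z f.
exists (f true @; p1 + f false @; p2); split=> [[]|g gE].
- by rewrite compDl -!compA p11 p21 compm0 addr0 compm1.
- by rewrite compDl -!compA p12 p22 compm0 add0r compm1.
by rewrite -!gE -!compA -compDr sum1 compm1.
Qed.

Lemma biproduct_sym X Y S : biproduct X Y S -> biproduct Y X S.
Proof.
move=> [i1 [i2 [p1 [p2 [p11 p22 p12 p21 sum1]]]]].
by exists i2, i1, p2, p1; split=> //; rewrite addrC.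
Qed.

Lemma is_biproduct_iso X Y S S' (a : hom S S') (b : hom S' S) i1 i2 p1 p2 :
  b @; a = idm S -> a @; b = idm S' -> @is_biproduct X Y S i1 i2 p1 p2 ->
  is_biproduct (a @; i1) (a @; i2) (p1 @; b) (p2 @; b).
Proof.
move=> ba ab [p11 p22 p12 p21 sum1]; split;
  rewrite ?compA -?(compA _ b) ?ba ?compm1 //.
by rewrite -!(compA a) -!compDr -compDl sum1 comp1m ab.
Qed.

Lemma biproduct_iso X Y S S' : isomorphic S S' -> biproduct X Y S -> biproduct X Y S'.
Proof.
move=> [a [b [ba ab]]] [i1 [i2 [p1 [p2 bp]]]].
by exists (a @; i1), (a @; i2), (p1 @; b), (p2 @; b); apply: is_biproduct_iso.
Qed.

Lemma biproduct_uniq X Y S S' : biproduct X Y S -> biproduct X Y S' -> isomorphic S S'.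
Proof.
move=> [i1 [i2 [p1 [p2 [p11 p22 p12 p21 sum1]]]]].
move=> [j1 [j2 [q1 [q2 [q11 q22 q12 q21 sum2]]]]].
exists (j1 @; p1 + j2 @; p2), (i1 @; q1 + i2 @; q2).
rewrite !compDl !compDr !compA -!(compA _ q1) -!(compA _ q2).
rewrite -!(compA _ p1) -!(compA _ p2).
rewrite p11 p22 p12 p21 q11 q22 q12 q21 !compm0 !comp0m !compm1 !addr0 !add0r.
by rewrite sum1 sum2.
Qed.

Lemma biproduct_zero X Y S : is_zero Y -> biproduct X Y S <-> isomorphic X S.
Proof.
move=> Y0; split=> [[i1 [i2 [p1 [p2 [p11 p22 p12 p21 sum1]]]]]|[a [b [ba ab]]]].
  exists i1, p1; split=> //; rewrite -sum1.
  by rewrite (is_zero_hom i2) ?comp0m ?addr0 //; left.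
exists a, 0, b, 0; split; rewrite ?compm0 ?comp0m ?addr0 //.
exact/esym/is_zero_idP.
Qed.

(** Reassociation: from [S = X + Y], [Y = U + V] and [W = X + V] follows
    [S = U + W], with explicit first injection and projection. *)
Lemma is_biproduct_exchange X Y S U V W
    i1 i2 p1 p2 j1 j2 q1 q2 k1 k2 r1 r2 :
  @is_biproduct X Y S i1 i2 p1 p2 -> @is_biproduct U V Y j1 j2 q1 q2 ->
  @is_biproduct X V W k1 k2 r1 r2 ->
  is_biproduct (i2 @; j1) (i1 @; r1 + i2 @; j2 @; r2)
    (q1 @; p2) (k1 @; p1 + k2 @; q2 @; p2).
Proof.
move=> [p11 p22 p12 p21 sum1] [q11 q22 q12 q21 sum2] [r11 r22 r12 r21 sum3].
split; rewrite ?compDl ?compDr ?compA.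
- by rewrite (comp_eqr p22) compm1.
- rewrite !(comp_eqr p11, comp_eqr p22,
    comp_eqr p12, comp_eqr p21).
  rewrite !(comp0m, compm0, compm1) (comp_eqr q22) compm1.
  by rewrite addr0 add0r.
- rewrite !(comp_eqr p22, comp_eqr p21).
  by rewrite !(comp0m, compm0, compm1) q12 comp0m addr0.
- rewrite !(comp_eqr p22, comp_eqr p12).
  by rewrite !(comp0m, compm0, compm1) (comp_eqr q21) compm0 addr0.
rewrite !(comp_eqr r11, comp_eqr r22,
    comp_eqr r12, comp_eqr r21).
rewrite !(comp0m, compm0, compm1) addr0 add0r addrCA -compDl.
by rewrite -!(compA i2) -compDr sum2 compm1.
Qed.

(** Cancellation: two complements of the summands [L] and [L'] are isomorphic as
    soon as the component [L -> L'] is an isomorphism. *)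
Lemma biproduct_cancel L X L' X' S iL iX pL pX jL jX qL qX :
  @is_biproduct L X S iL iX pL pX -> @is_biproduct L' X' S jL jX qL qX ->
  is_iso (qL @; iL) -> isomorphic X X'.
Proof.
move=> [p11 p22 p12 p21 sum1] [q11 q22 q12 q21 sum2] [c [ca ac]].
pose e := idm S - iL @; c @; qL.
have eiL : e @; iL = 0.
  by rewrite compBl comp1m -!compA ca compm1 subrr.
have qLe : qL @; e = 0.
  by rewrite compBr compm1 !compA ac comp1m subrr.
exists (qX @; e @; iX), (pX @; jX); split.
  have -> : pX @; jX @; (qX @; e @; iX) = pX @; ((jX @; qX) @; e) @; iX.
    by rewrite !compA.
  have -> : jX @; qX = idm S - jL @; qL by rewrite -sum2 addrC addKr.
  rewrite compBl comp1m -(compA jL) qLe compm0 subr0.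
  rewrite compBr compm1 compBl p22 !compA p21.
  by rewrite !comp0m subr0.
have -> : qX @; e @; iX @; (pX @; jX) = qX @; (e @; (iX @; pX)) @; jX.
  by rewrite !compA.
have -> : iX @; pX = idm S - iL @; pL by rewrite -sum1 addrC addKr.
rewrite compBr compm1 compA eiL comp0m subr0.
rewrite compBr compm1 compBl q22 -!compA q12.
by rewrite !compm0 subr0.
Qed.

End PreadditiveAlgebra.

(** * Finite coproducts *)

Section FiniteCoproducts.
Variable C : additiveCat.
Implicit Types X Y Z W S L O : C.

Lemma biproduct_congr (X Y S X' Y' : C) : isomorphic X X' -> isomorphic Y Y' ->
  biproduct X Y S -> biproduct X' Y' S.
Proof.
move=> [a [a' [a'a aa']]] [b [b' [b'b bb']]].
move=> [i1 [i2 [p1 [p2 [p11 p22 p12 p21 sum1]]]]].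
exists (i1 @; a'), (i2 @; b'), (a @; p1), (b @; p2).
split; rewrite ?compA.
- by rewrite (comp_eqr p11) compm1.
- by rewrite (comp_eqr p22) compm1.
- by rewrite (comp_eqr p12) compm0 comp0m.
- by rewrite (comp_eqr p21) compm0 comp0m.
- by rewrite (comp_eqr a'a) (comp_eqr b'b) !compm1.
Qed.

(** Dependent families on [n.+1] indices, given by their first term and their
    tail. *)
Lemma ord_family_ex n (P : 'I_n.+1 -> Type) (f0 : P ord0)
    (fs : forall k, P (fintype.lift ord0 k)) :
  exists f : forall k, P k, f ord0 = f0 /\ forall k, f (fintype.lift ord0 k) = fs k.
Proof.
exists (fun k => match unliftP ord0 k with
  | UnliftSome j e => ecast k (P k) (esym e) (fs j)
  | UnliftNone e => ecast k (P k) (esym e) f0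
  end).
split=> [|k].
  by case: (unliftP ord0 ord0) => [j|] e //; rewrite eq_axiomK.
case: (unliftP ord0 (fintype.lift ord0 k)) => [j|] e //.
by have ek := lift_inj e; case: j / ek e => e; rewrite eq_axiomK.
Qed.

Lemma coproduct_nil (X : 'I_0 -> C) S : coproduct_of X S -> is_zero S.
Proof.
move=> [i iP]; apply/is_zero_idP.
have [g [_ gU]] := iP S (fun k => i k).
by rewrite -(gU 0) ?(gU (idm S)) // => -[].
Qed.

Lemma coproduct_nil_ex : exists (X : 'I_0 -> C) S, coproduct_of X S.
Proof.
pose X (k : 'I_0) := False_rect C (elimF idP (ltn0 k) (ltn_ord k)).
by exists X; apply: has_coproducts.
Qed.

Lemma zero_ex : exists O, is_zero O.
Proof.
by have [X [S SP]] := coproduct_nil_ex; exists S; apply: coproduct_nil SP.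
Qed.

(** A finite coproduct is the biproduct of its first term and a coproduct of the
    remaining ones. *)
Lemma coproduct_cons n (X : 'I_n.+1 -> C) S : coproduct_of X S ->
  exists S', biproduct (X ord0) S' S /\
    coproduct_of (fun k => X (fintype.lift ord0 k)) S'.
Proof.
move=> [i iP].
have [S' [j jP]] := has_coproducts (fun k => X (fintype.lift ord0 k)).
exists S'; split; last by exists j.
have [i2 [i2j _]] := jP _ (fun k => i (fintype.lift ord0 k)).
have [f [f0 fl]] := ord_family_ex (P := fun k => hom (X k) (X ord0)) (idm _) (fun _ => 0).
have [p1 [p1i _]] := iP _ f.
have [g [g0 gl]] := ord_family_ex (P := fun k => hom (X k) S') 0 j.
have [p2 [p2i _]] := iP _ g.
exists (i ord0), i2, p1, p2; split.
- by rewrite p1i f0.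
- have [h [_ hU]] := jP _ j.
  rewrite -(hU (idm S')); last by move=> k; rewrite comp1m.
  by apply/esym/hU => k; rewrite -compA i2j p2i gl.
- have [h [_ hU]] := jP (X ord0) (fun _ => 0).
  rewrite -(hU 0); last by move=> k; rewrite comp0m.
  by apply/esym/hU => k; rewrite -compA i2j p1i fl.
- by rewrite p2i g0.
have [h [_ hU]] := iP _ i.
rewrite -(hU (idm S)); last by move=> k; rewrite comp1m.
apply/esym/hU => k; rewrite compDl -!compA p1i p2i.
case: (unliftP ord0 k) => [l|] ->.
  by rewrite fl gl compm0 add0r i2j.
by rewrite f0 g0 compm0 addr0 compm1.
Qed.

(** The two-term family with members [X], [Y]. *)
Definition ord_pair X Y : 'I_2 -> C := fun k => if k == ord0 then X else Y.

Lemma coproduct_pair X Y S : coproduct_of (ord_pair X Y) S -> biproduct X Y S.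
Proof.
move=> /coproduct_cons[S' [XS /coproduct_cons[O [YO /coproduct_nil O0]]]].
have YS' := (biproduct_zero _ _ O0).1 YO.
exact: biproduct_congr (isomorphic_refl _) (isomorphic_sym YS') XS.
Qed.

Lemma biproduct_ex X Y : exists S, biproduct X Y S.
Proof.
by have [S /coproduct_pair] := has_coproducts (ord_pair X Y); exists S.
Qed.

Lemma biproduct_assoc X Y S U V : biproduct X Y S -> biproduct U V X ->
  exists W, biproduct U W S /\ biproduct V Y W.
Proof.
move=> /biproduct_sym[i1 [i2 [p1 [p2 bp]]]] [j1 [j2 [q1 [q2 bq]]]].
have [W VW] := biproduct_ex V Y.
have /biproduct_sym[k1 [k2 [r1 [r2 br]]]] := VW.
by exists W; split=> //; do 4!eexists; apply: is_biproduct_exchange bp bq br.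
Qed.

Section Subcategory.
Variables (M : set C) (subM : is_subcategory M).

Lemma sub_biproduct X Y S : M X -> M Y -> biproduct X Y S -> M S.
Proof.
move=> MX MY XYS; have [S' S'P] := has_coproducts (ord_pair X Y).
apply: (sub_iso subM (biproduct_uniq (coproduct_pair S'P) XYS)).
by apply: sub_coproduct S'P => // k; rewrite /ord_pair; case: ifP.
Qed.

Lemma sub_biproduct_l X Y S : biproduct X Y S -> M S -> M X.
Proof.
move=> XYS; apply: (sub_summand subM).
by exists Y; apply/biproduct_coproduct2.
Qed.

Lemma sub_zero O : is_zero O -> M O.
Proof.
move=> O0; have [X [S SP]] := coproduct_nil_ex.
apply: (sub_iso subM) (is_zero_isomorphic (coproduct_nil SP) O0) _.
by apply: sub_coproduct SP => // -[].
Qed.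

End Subcategory.

Lemma closed_coproduct (M : set C) :
  (forall O, is_zero O -> M O) ->
  (forall X Y S, biproduct X Y S -> M X -> M Y -> M S) ->
  forall n (X : 'I_n -> C) S, (forall k, M (X k)) -> coproduct_of X S -> M S.
Proof.
move=> M0 MD; elim=> [|n IHn] X S MX; first by move/coproduct_nil/M0.
move=> /coproduct_cons[S' [XS' S'P]].
by apply: MD XS' (MX _) (IHn _ _ _ S'P).
Qed.

End FiniteCoproducts.

(** * Objects with local endomorphism rings *)

Section Local.
Variable C : preadditiveCat.
Implicit Types X Y Z W S L : C.

(** Objects whose endomorphism ring is local. *)
Definition is_local L : Prop := local_ring (End L).

Lemma local_sum L (f g : hom L L) : is_local L -> is_iso (f + g) ->
  is_iso f \/ is_iso g.
Proof.
move=> [_ locL] ufg; apply: contrapT => /not_orP[nf ng].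
exact: (locL f g nf ng).
Qed.

Lemma local_neq0 L : is_local L -> ~ is_zero L.
Proof. by move=> [one0 _] /is_zero_idP. Qed.

Lemma local_idempotent L (e : hom L L) : is_local L -> e @; e = e ->
  e = 0 \/ e = idm L.
Proof.
move=> locL ee.
have : is_iso (e + (idm L - e)) by rewrite addrC subrK; apply: is_iso_id.
case/(local_sum locL) => -[u [ue eu]]; [right|left].
  by rewrite -{1}(comp1m e) -ue -compA ee.
rewrite -[e]compm1 -eu compA compBr compm1 ee subrr.
by rewrite comp0m.
Qed.

(** A split monomorphism between objects with local endomorphism rings is an
    isomorphism. *)
Lemma local_retract L Y (a : hom L Y) (b : hom Y L) :
  is_local L -> is_local Y -> is_iso (b @; a) -> is_iso a.
Proof.
move=> locL locY [u [uba bau]]; exists (u @; b); split; first by rewrite -compA.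
have [|e0|//] := @local_idempotent _ (a @; (u @; b)) locY.
  by rewrite -!compA [b @; (_ @; _)]compA (compA u) uba comp1m.
case: (local_neq0 locL); apply/is_zero_idP.
have -> : idm L = u @; b @; (a @; (u @; b)) @; a.
  by rewrite !compA -(compA u b a) uba comp1m -compA uba.
by rewrite e0 compm0 comp0m.
Qed.

Lemma local_indecomposable L : is_local L -> indecomposable L.
Proof.
move=> locL; split; first exact: local_neq0.
move=> Y Z /biproduct_coproduct2[i1 [i2 [p1 [p2 [p11 p22 p12 p21 sum1]]]]].
have [|e0|e1] := @local_idempotent _ (i1 @; p1) locL.
- by rewrite compA (comp_eqr p11) compm1.
- left; apply/is_zero_idP.
  have -> : idm Y = p1 @; (i1 @; p1) @; i1 by rewrite compA p11 comp1m p11.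
  by rewrite e0 compm0 comp0m.
- by right; apply/is_zero_idP; rewrite -p22 -(compm1 p2) -e1 compA p21 !comp0m.
Qed.

End Local.

(** * Uniqueness of Krull-Schmidt decompositions *)

Section Decompositions.
Variable C : additiveCat.
Implicit Types (X Y Z W S L : C) (s t : seq C).

(** [decomposes s S]: the object [S] is the direct sum of the objects listed in
    [s], all of which have local endomorphism rings. *)
Inductive decomposes : seq C -> C -> Prop :=
| decomposes_nil S : is_zero S -> decomposes [::] S
| decomposes_cons L s S S' : is_local L -> decomposes s S' ->
    biproduct L S' S -> decomposes (L :: s) S.

Lemma decomposes_nilP S : decomposes [::] S -> is_zero S.
Proof. by move E: [::] => s d; case: d E. Qed.

Lemma decomposes_consP L s S : decomposes (L :: s) S ->
  exists S', [/\ is_local L, decomposes s S' & biproduct L S' S].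
Proof.
move E: (L :: s) => t d; case: d E => // L' s' S0 S' locL ds bp [-> ->].
by exists S'.
Qed.

Lemma decomposes_zero s S : decomposes s S -> is_zero S -> s = [::].
Proof.
case: s => // L s /decomposes_consP[S' [locL _ [i1 [i2 [p1 [p2 [p11 _ _ _ _]]]]]]] S0.
case: (local_neq0 locL); apply/is_zero_idP.
by rewrite -p11 (is_zero_hom i1) ?compm0 //; right.
Qed.

Lemma decomposes_iso s X Y : isomorphic X Y -> decomposes s X -> decomposes s Y.
Proof.
move=> XY; case: s => [/decomposes_nilP|L s /decomposes_consP[S' [locL ds bp]]].
  by move=> X0; apply/decomposes_nil/(is_zero_iso XY).
exact: decomposes_cons locL ds (biproduct_iso XY bp).
Qed.

Lemma decomposes_cat s t X Y S : decomposes s X -> decomposes t Y ->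
  biproduct X Y S -> decomposes (s ++ t) S.
Proof.
elim: s X S => [|L s IHs] X S.
  move=> /decomposes_nilP X0 dt /biproduct_sym/(biproduct_zero _ _ X0) YS.
  exact: decomposes_iso dt.
move=> /decomposes_consP[X' [locL ds LX']] dt XYS.
have [W [LW X'YW]] := biproduct_assoc XYS LX'.
exact: decomposes_cons locL (IHs _ _ ds dt X'YW) LW.
Qed.

(** Since [L] is local and [f @; g] is the sum of its components through the
    members of [s], one of these components is invertible. *)
Lemma decomposes_component s S L (f : hom S L) (g : hom L S) :
  decomposes s S -> is_local L -> is_iso (f @; g) ->
  exists s1 Y s2 S' iY iS' (pY : hom S Y) (pS' : hom S S'),
    [/\ s = s1 ++ Y :: s2, is_local Y, is_biproduct iY iS' pY pS',
        is_iso (f @; iY @; (pY @; g)) & decomposes (s1 ++ s2) S'].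
Proof.
elim: s S f g => [|Y s IHs] S f g.
  move=> /decomposes_nilP S0 locL [u [ufg _]].
  case: (local_neq0 locL); apply/is_zero_idP.
  by rewrite -ufg (is_zero_hom f) ?comp0m ?compm0 //; left.
move=> /decomposes_consP[S' [locY ds bp]] locL.
have [i1 [i2 [p1 [p2 bP]]]] := bp.
have [p11 p22 p12 p21 sum1] := bP.
have -> : f @; g = f @; i1 @; (p1 @; g) + f @; i2 @; (p2 @; g).
  by rewrite -!(compA f) -compDr !compA -compDl sum1 comp1m.
case/(local_sum locL) => [u1|u2].
  by exists [::], Y, s, S', i1, i2, p1, p2.
have [s1 [Y1 [s2 [S1 [j1 [j2 [q1 [q2 [-> locY1 bQ u ds1]]]]]]]]] := IHs _ _ _ ds locL u2.
have [W YW] := biproduct_ex Y S1.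
have [k1 [k2 [r1 [r2 bR]]]] := YW.
exists (Y :: s1), Y1, s2, W; do 4!eexists.
split; first by []; first by []; first exact: is_biproduct_exchange bP bQ bR.
  by rewrite !compA in u *.
exact: decomposes_cons locY ds1 YW.
Qed.

(** Exchange: a local summand [L] of [S] is one of the members of any
    decomposition of [S], and the other members decompose its complement. *)
Lemma decomposes_exchange s S L X : decomposes s S -> is_local L ->
  biproduct L X S ->
  exists s1 Y s2, [/\ s = s1 ++ Y :: s2, isomorphic L Y & decomposes (s1 ++ s2) X].
Proof.
move=> ds locL [iL [iX [pL [pX bp]]]]; have [pLL _ _ _ _] := bp.
have [|s1 [Y [s2 [S' [iY [iS [pY [pS [-> locY bq u ds1]]]]]]]]] :=
  @decomposes_component s S L pL iL ds locL.
  by rewrite pLL; apply: is_iso_id.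
have LY : is_iso (pY @; iL) := local_retract locL locY u.
exists s1, Y, s2; split=> //; first by exists (pY @; iL).
by apply: decomposes_iso ds1; apply/isomorphic_sym/(biproduct_cancel bp bq LY).
Qed.

(** The Krull-Remak-Schmidt-Azumaya theorem. *)
Theorem decomposes_uniq s t S : decomposes s S -> decomposes t S ->
  perm_eq [seq iso_class L | L <- s] [seq iso_class L | L <- t].
Proof.
elim: s t S => [|L s IHs] t S.
  by move=> /decomposes_nilP S0 /decomposes_zero->.
move=> /decomposes_consP[S' [locL ds bp]] dt.
have [t1 [Y [t2 [-> /iso_classP LY dt']]]] := decomposes_exchange dt locL bp.
rewrite map_cat /= perm_sym perm_catC /= LY perm_cons perm_catC -map_cat perm_sym.
exact: IHs ds dt'.
Qed.

(** [split_class X v]: the formal sum of the isomorphism classes of the members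
    of a decomposition of [X] is [v].  This is the class of [X] in the split
    Grothendieck group, as a relation between the object and its class. *)
Definition split_class X (v : {freeg isoclass C}) : Prop :=
  exists2 s, decomposes s X & v = \sum_(L <- s) << iso_class L >>.

Lemma split_class_uniq X v w : split_class X v -> split_class X w -> v = w.
Proof.
move=> [s ds ->] [t dt ->].
rewrite -(big_map (@iso_class C) xpredT (fun c => << c >>)).
rewrite -(big_map (@iso_class C) xpredT (fun c => << c >>)).
exact: perm_big (decomposes_uniq ds dt).
Qed.

Lemma split_class_iso X Y v : isomorphic X Y -> split_class X v -> split_class Y v.
Proof. by move=> XY [s ds ->]; exists s => //; apply: decomposes_iso ds. Qed.

Lemma split_class_biproduct X Y S v w : split_class X v -> split_class Y w ->
  biproduct X Y S -> split_class S (v + w).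
Proof.
move=> [s ds ->] [t dt ->] XYS; exists (s ++ t); last by rewrite big_cat.
exact: decomposes_cat ds dt XYS.
Qed.

Lemma split_class_zero O : is_zero O -> split_class O 0.
Proof. by move=> O0; exists [::]; rewrite ?big_nil //; apply: decomposes_nil. Qed.

Hypothesis KS : krull_schmidt C.

Lemma krull_schmidt_decomposes S : exists s, decomposes s S.
Proof.
have [n [X [locX]]] := KS S.
elim: n X S locX => [|n IHn] X S locX.
  by move=> /coproduct_nil S0; exists [::]; apply: decomposes_nil.
move=> /coproduct_cons[S' [bp S'P]].
have [s ds] := IHn _ _ (fun k => locX (fintype.lift ord0 k)) S'P.
by exists (X ord0 :: s); apply: decomposes_cons (locX ord0) ds bp.
Qed.

Lemma split_class_ex X : exists v, split_class X v.
Proof. by have [s ds] := krull_schmidt_decomposes X; eexists; exists s. Qed.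

Lemma split_class_indecomposable X : indecomposable X ->
  split_class X << iso_class X >>.
Proof.
move=> [X0 indX]; have [s ds] := krull_schmidt_decomposes X.
case: s ds => [/decomposes_nilP//|L s /decomposes_consP[S [locL ds bp]]].
have [/(local_neq0 locL)//|S0] := indX _ _ ((biproduct_coproduct2 _ _ _).2 bp).
have LX := (biproduct_zero _ _ S0).1 bp.
exists [:: L]; last by rewrite big_seq1 ((iso_classP _ _).2 LX).
by apply: decomposes_cons bp => //; apply: decomposes_nil.
Qed.

End Decompositions.

(** * Additive functors and the shift *)

Section AdditiveFunctors.
Variables C D : preadditiveCat.
Implicit Types F : additiveFunctor C D.

Lemma fmap0 F X Y : fmap F (0 : hom X Y) = 0.
Proof. by apply: (addIr (fmap F 0)); rewrite -fmapD addr0 add0r. Qed.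

Lemma fmapN F X Y (f : hom X Y) : fmap F (- f) = - fmap F f.
Proof. by apply: (addIr (fmap F f)); rewrite -fmapD !addNr fmap0. Qed.

Lemma fmap_isomorphic F X Y : isomorphic X Y -> isomorphic (F X) (F Y).
Proof.
move=> [f [g [gf fg]]]; exists (fmap F f), (fmap F g).
by rewrite -!fmap_comp gf fg !fmap1.
Qed.

Lemma fmap_biproduct F X Y S : biproduct X Y S -> biproduct (F X) (F Y) (F S).
Proof.
move=> [i1 [i2 [p1 [p2 [p11 p22 p12 p21 sum1]]]]].
exists (fmap F i1), (fmap F i2), (fmap F p1), (fmap F p2).
by split; rewrite -!fmap_comp ?p11 ?p22 ?p12 ?p21 ?fmap1 ?fmap0 // -fmapD sum1 fmap1.
Qed.

Lemma fmap_faithful F (G : additiveFunctor D C) : left_quasi_inverse F G ->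
  forall X Y, injective (@fmap _ _ F X Y).
Proof.
move=> [e [eiso enat]] X Y f g fg.
have [d [de ed]] := eiso X.
by rewrite -(compm1 f) -(compm1 g) -ed !compA !enat fg.
Qed.

End AdditiveFunctors.

Lemma fmap_full (C D : preadditiveCat) (F : additiveFunctor C D)
    (G : additiveFunctor D C) :
  left_quasi_inverse F G -> left_quasi_inverse G F ->
  forall X Y (k : hom (F X) (F Y)), exists f, fmap F f = k.
Proof.
move=> [e [eiso enat]] GF X Y k.
have [d [de ed]] := eiso X; have [c [ce ec]] := eiso Y.
exists (e Y @; fmap G k @; d); apply: (fmap_faithful GF).
rewrite -[LHS]comp1m -ce -compA -enat -!compA de compm1 compA ce.
by rewrite comp1m.
Qed.

(** The [n]-fold shift [X[n]]. *)
Local Notation sh n X := (iter n (shift _) X).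

Section Shift.
Variable T : triangulatedCat.
Implicit Types X Y Z W S A B O : T.

Lemma shift_faithful X Y : injective (@fmap _ _ (shift T) X Y).
Proof. exact (@fmap_faithful _ _ _ _ (shiftK T) X Y). Qed.

Lemma shift_full X Y (k : hom (shift T X) (shift T Y)) :
  exists f, fmap (shift T) f = k.
Proof. exact (fmap_full (shiftK T) (unshiftK T) k). Qed.

Lemma shift_isomorphicP X Y : isomorphic (shift T X) (shift T Y) <-> isomorphic X Y.
Proof.
split=> [[f [g [gf fg]]]|]; last exact: fmap_isomorphic.
have [f' ff'] := shift_full f; have [g' gg'] := shift_full g.
exists f', g'; split; apply: shift_faithful.
  by rewrite fmap_comp ff' gg' gf fmap1.
by rewrite fmap_comp ff' gg' fg fmap1.
Qed.

Lemma shift_unshift X : isomorphic (shift T (unshift T X)) X.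
Proof. by have [e [eiso _]] := unshiftK T; exists (e X). Qed.

Lemma shift_surj X : exists Y, isomorphic (shift T Y) X.
Proof. by exists (unshift T X); apply: shift_unshift. Qed.

Lemma shift_zero O : is_zero O -> is_zero (shift T O).
Proof. by move=> /is_zero_idP O0; apply/is_zero_idP; rewrite -fmap1 O0 fmap0. Qed.

Lemma shift_biproductP X Y S :
  biproduct (shift T X) (shift T Y) (shift T S) <-> biproduct X Y S.
Proof.
split=> [|]; last exact: fmap_biproduct.
move=> [i1 [i2 [p1 [p2]]]].
have [i1' <-] := shift_full i1; have [i2' <-] := shift_full i2.
have [p1' <-] := shift_full p1; have [p2' <-] := shift_full p2.
move=> [p11 p22 p12 p21 sum1]; exists i1', i2', p1', p2'.
by split; apply: shift_faithful; rewrite ?fmapD !fmap_comp ?fmap1 ?fmap0.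
Qed.

Lemma iter_shift_isomorphicP n X Y : isomorphic (sh n X) (sh n Y) <-> isomorphic X Y.
Proof. by elim: n => //= n <-; apply: shift_isomorphicP. Qed.

Lemma iter_shift_biproductP n X Y S :
  biproduct (sh n X) (sh n Y) (sh n S) <-> biproduct X Y S.
Proof. by elim: n => //= n <-; apply: shift_biproductP. Qed.

Lemma iter_shift_surj n X : exists Y, isomorphic (sh n Y) X.
Proof.
elim: n X => [|n IHn] X; first by exists X; apply: isomorphic_refl.
have [Z ZX] := shift_surj X; have [Y YZ] := IHn Z; exists Y.
exact: isomorphic_trans ((shift_isomorphicP _ _).2 YZ) ZX.
Qed.

Lemma iter_shift_zero n O : is_zero O -> is_zero (sh n O).
Proof. by move=> O0; elim: n => //= n; apply: shift_zero. Qed.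

Lemma iter_shift_hom0 n X Y : (forall f : hom X Y, f = 0) ->
  forall f : hom (sh n X) (sh n Y), f = 0.
Proof.
move=> XY0; elim: n => //= n IHn f.
by have [g <-] := shift_full f; rewrite (IHn g) fmap0.
Qed.

End Shift.

(** * Extensions and distinguished triangles *)

Section Triangles.
Variable T : triangulatedCat.
Implicit Types X Y Z W S A B O P Q : T.

Lemma hom0_iso X X' Y Y' : isomorphic X X' -> isomorphic Y Y' ->
  (forall f : hom X Y, f = 0) -> forall f : hom X' Y', f = 0.
Proof.
move=> [a [a' [a'a aa']]] [b [b' [b'b bb']]] XY0 f.
rewrite -(comp1m f) -bb' -(compm1 f) -aa' !compA -(compA b) -(compA b).
by rewrite (XY0 (b' @; f @; a)) compm0 comp0m.
Qed.

Lemma dist_comp0 X Y Z (f : hom X Y) (g : hom Y Z) (h : hom Z (shift T X)) :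
  dist f g h -> g @; f = 0.
Proof.
move=> fgh; have [O O0] := zero_ex T.
have [|c [<- _]] := dist_morph (a := idm X) (b := f) (dist_id X O0) fgh => //.
by rewrite compm0.
Qed.

(** Exactness of [hom W -] at the middle term of a triangle. *)
Lemma dist_exact X Y Z W (f : hom X Y) (g : hom Y Z) (h : hom Z (shift T X))
    (t : hom W Y) :
  dist f g h -> g @; t = 0 -> exists r, f @; r = t.
Proof.
move=> fgh gt0; have [O O0] := zero_ex T.
have [|c [_]] := dist_morph (a := t) (b := 0 : hom O Z)
  ((dist_rot _ _ _).1 (dist_id W O0)) ((dist_rot _ _ _).1 fgh).
  by rewrite gt0 comp0m.
have [r <-] := shift_full c; rewrite fmap1 compmN compm1 compNm -fmap_comp.
by move=> /oppr_inj/shift_faithful ->; exists r.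
Qed.

(** Some distinguished triangle [X -> Y -> Z -> X[1]] exists; its morphisms are
    forgotten, and [Y] is only known to be an extension of [Z] by [X]. *)
Definition triangle X Y Z : Prop :=
  exists (f : hom X Y) (g : hom Y Z) (h : hom Z (shift T X)), dist f g h.

Lemma triangle_iso X X' Y Y' Z Z' :
  isomorphic X X' -> isomorphic Y Y' -> isomorphic Z Z' ->
  triangle X Y Z -> triangle X' Y' Z'.
Proof.
move=> [a [a' [a'a aa']]] [b [b' [b'b bb']]] [c [c' [c'c cc']]] [f [g [h fgh]]].
exists (b @; f @; a'), (c @; g @; b'), (fmap (shift T) a @; h @; c').
apply: (dist_iso (a := a) (b := b) (c := c)) fgh.
- by exists a'.
- by exists b'.
- by exists c'.
- by rewrite (comp_eqr a'a) compm1.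
- by rewrite (comp_eqr b'b) compm1.
- by rewrite (comp_eqr c'c) compm1.
Qed.

Lemma triangle_rot X Y Z : triangle X Y Z -> triangle Y Z (shift T X).
Proof. by move=> [f [g [h /dist_rot ?]]]; do 3!eexists; eassumption. Qed.

Lemma triangle_shift X Y Z : triangle X Y Z ->
  triangle (shift T X) (shift T Y) (shift T Z).
Proof. by do 3!move/triangle_rot. Qed.

Lemma triangle_unrot X Y Z : triangle Y Z (shift T X) -> triangle X Y Z.
Proof.
move=> [g [h [k ghk]]]; have [f fk] := shift_full k.
exists (- f), g, h; apply/dist_rot.
by rewrite fmapN opprK fk.
Qed.

Lemma triangle_unrot_ex Y Z Q : triangle Y Z Q ->
  exists2 X, isomorphic (shift T X) Q & triangle X Y Z.
Proof.
move=> YZQ; have [X XQ] := shift_surj Q; exists X => //.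
apply: triangle_unrot; apply: triangle_iso YZQ; try exact: isomorphic_refl.
exact: isomorphic_sym.
Qed.

Lemma triangle_unshift X Y Z :
  triangle (shift T X) (shift T Y) (shift T Z) -> triangle X Y Z.
Proof. by do 3!move/triangle_unrot. Qed.

Lemma triangle_hom0 W X Y Z : triangle X Y Z ->
  (forall f : hom W X, f = 0) -> (forall f : hom W Z, f = 0) ->
  forall f : hom W Y, f = 0.
Proof.
move=> [f [g [h fgh]]] WX WZ t.
by have [r <-] := dist_exact fgh (WZ (g @; t)); rewrite (WX r) compm0.
Qed.

Lemma triangle_zero_r X Y O : is_zero O -> isomorphic X Y -> triangle X Y O.
Proof.
move=> O0 XY; have := dist_id X O0 => d.
apply: (triangle_iso (isomorphic_refl X) XY (isomorphic_refl O)).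
by exists (idm X), 0, 0.
Qed.

Lemma triangle_zero_l X Y O : is_zero O -> isomorphic X Y -> triangle O X Y.
Proof.
move=> O0 XY; apply: triangle_unrot; apply: triangle_zero_r XY.
exact: shift_zero.
Qed.

Lemma triangle_shift_cone X O : is_zero O -> triangle X O (shift T X).
Proof.
by move=> O0; apply/triangle_rot/triangle_zero_r => //; apply: isomorphic_refl.
Qed.

(** A triangle whose connecting morphism vanishes splits. *)
Lemma dist_split X Y Z (f : hom X Y) (g : hom Y Z) :
  dist f g 0 -> exists r s, is_biproduct f s r g.
Proof.
move=> fg0; have gf0 := dist_comp0 fg0; have g0f := (dist_rot _ _ _).1 fg0.
have [|s gs] := @dist_exact _ _ _ Z _ _ _ (idm Z) g0f; first by rewrite comp0m.
have [|r fr] := @dist_exact _ _ _ Y _ _ _ (idm Y - s @; g) fg0.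
  by rewrite compBr compm1 compA gs comp1m subrr.
have fmono W (t : hom W X) : f @; t = 0 -> t = 0.
  move=> ft0; have [|u u0] := @dist_exact _ _ _ (shift T W) _ _ _
    (fmap (shift T) t) ((dist_rot _ _ _).1 g0f).
    by rewrite compNm -fmap_comp ft0 fmap0 oppr0.
  by apply: shift_faithful; rewrite -u0 comp0m fmap0.
exists r, s; split=> //.
- apply/eqP; rewrite -subr_eq0; apply/eqP/fmono.
  by rewrite compBr compA fr compBl -compA gf0 comp1m compm0 compm1 subr0 subrr.
- by apply: fmono; rewrite compA fr compBl comp1m -compA gs compm1 subrr.
by rewrite fr subrK.
Qed.

Lemma triangle_split X Y Z : triangle X Y Z ->
  (forall f : hom Z (shift T X), f = 0) -> biproduct X Z Y.
Proof.
move=> [f [g [h fgh]]] ZX0; rewrite (ZX0 h) in fgh.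
by have [r [s bp]] := dist_split fgh; exists f, s, r, g.
Qed.

(** Split triangles are distinguished. *)
Lemma dist_biproduct X Y S i1 i2 p1 p2 :
  @is_biproduct T X Y S i1 i2 p1 p2 -> dist i1 p2 (0 : hom Y (shift T X)).
Proof.
move=> [p11 p22 p12 p21 sum1].
(* The connecting morphism of a split monomorphism is zero. *)
have [W [g [h igh]]] := dist_ex i1.
have h0 : h = 0.
  have /eqP := dist_comp0 ((dist_rot _ _ _).1 ((dist_rot _ _ _).1 igh)).
  rewrite compNm oppr_eq0 => /eqP ih0.
  by rewrite -(comp1m h) -fmap1 -p11 fmap_comp -compA ih0 compm0.
rewrite h0 in igh; have gi0 := dist_comp0 igh.
have [r [s [ri gs rs _ sum2]]] := dist_split igh.
have sgE : s @; g = idm S - i1 @; r by rewrite -sum2 addrC addKr.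
have ipE : i2 @; p2 = idm S - i1 @; p1 by rewrite -sum1 addrC addKr.
apply: (@dist_iso T _ _ _ _ _ _ _ _ _ _ _ _ (idm X) (idm S) (p2 @; s)) igh.
- exact: is_iso_id.
- exact: is_iso_id.
- exists (g @; i2); split.
    rewrite compA -(compA g) ipE compBr compm1 compBl gs compA gi0.
    by rewrite !comp0m subr0.
  rewrite compA -(compA p2) sgE compBr compm1 compBl p22 compA p21.
  by rewrite !comp0m subr0.
- by rewrite comp1m compm1.
- by rewrite compm1 -compA sgE compBr compm1 compA p21 comp0m subr0.
- by rewrite comp0m compm0.
Qed.

Lemma triangle_biproduct X Y S : biproduct X Y S -> triangle X S Y.
Proof.
by move=> [i1 [i2 [p1 [p2 /dist_biproduct]]]]; exists i1, p2, 0.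
Qed.

(** If [hom B A[1]] vanishes, an extension of [B] by [A] is also one of [A] by
    [B], both being split. *)
Lemma triangle_swap A E B : triangle A E B ->
  (forall f : hom B (shift T A), f = 0) -> triangle B E A.
Proof. by move=> tr BA0; apply/triangle_biproduct/biproduct_sym/triangle_split. Qed.

(** Extensions are associative: [triangle_assoc_l] and [triangle_assoc_r] rebracket
    a twofold extension in the two directions, by the octahedral axiom. *)
Lemma triangle_assoc_l A X X1 Y Z : triangle A X X1 -> triangle X Y Z ->
  exists Q, triangle A Y Q /\ triangle X1 Q Z.
Proof.
move=> [f [i [j d1]]] [g [k [l d2]]].
have [Q [m [n d3]]] := dist_ex (g @; f).
have [u [v [d4 _ _]]] := dist_octa d1 d2 d3.
by exists Q; split; do 3!eexists; eassumption.
Qed.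

Lemma triangle_assoc_r X1 Q Z B Z1 : triangle X1 Q Z -> triangle B Z Z1 ->
  exists R, triangle X1 R B /\ triangle R Q Z1.
Proof.
move=> /triangle_rot QZ /triangle_rot ZZ1.
have [R' [/triangle_unrot_ex[R RR' RQ] tr]] := triangle_assoc_l QZ ZZ1.
exists R; split=> //; apply: triangle_unshift.
by apply: triangle_iso tr; try exact: isomorphic_refl; apply: isomorphic_sym.
Qed.

(** The triangulated form of Schanuel's lemma: for morphisms [A -> X] and
    [A' -> X] with cones [Y] and [Y'], one object [P] is both an extension of
    [A'[1]] by [Y] and of [A[1]] by [Y']. *)
Lemma triangle_schanuel A A' X Y Y' : triangle A X Y -> triangle A' X Y' ->
  exists P, triangle Y P (shift T A') /\ triangle Y' P (shift T A).
Proof.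
move=> /triangle_rot XY A'X.
have [P [/triangle_rot ? ?]] := triangle_assoc_l A'X XY.
by exists P.
Qed.

(** Horseshoe lemma: resolutions of the ends of a triangle extend to its middle. *)
Lemma triangle_horseshoe X Y Z A X1 B Z1 : triangle X Y Z ->
  triangle A X X1 -> triangle B Z Z1 -> (forall f : hom B (shift T X1), f = 0) ->
  exists E Y1, [/\ triangle A E B, triangle E Y Y1 & triangle X1 Y1 Z1].
Proof.
move=> XYZ AX BZ BX1.
have [Q [AYQ X1QZ]] := triangle_assoc_l AX XYZ.
have [R [/triangle_swap/(_ BX1) BRX1 RQZ1]] := triangle_assoc_r X1QZ BZ.
have [Y1 [BQY1 tr1]] := triangle_assoc_l BRX1 RQZ1.
have [E [AEB EYY1]] := triangle_assoc_r AYQ BQY1.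
by exists E, Y1.
Qed.

(** If [Z = Z1 + Z2] and [A -> Z] has the cone [Y], then the cones [W1] and [W2]
    of the components [A -> Z1] and [A -> Z2] have a sum which is an extension
    of [A[1]] by [Y]. *)
Lemma triangle_summand A Z Y Z1 Z2 : triangle A Z Y -> biproduct Z1 Z2 Z ->
  exists W1 W2 P, [/\ triangle A Z1 W1, triangle A Z2 W2,
    triangle Y P (shift T A) & biproduct W1 W2 P].
Proof.
move=> [f [q [r d]]] [i1 [i2 [p1 [p2 bp]]]].
have bp' : is_biproduct i2 i1 p2 p1.
  by case: bp => *; split=> //; rewrite addrC.
have [_ p22 _ _ _] := bp.
have [W1 [m1 [n1 d1]]] := dist_ex (p1 @; f).
have [W2 [m2 [n2 d2]]] := dist_ex (p2 @; f).
have dp := (dist_rot _ _ _).1 (dist_biproduct bp').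
have [u [v [duv _ [_ lv]]]] := dist_octa d dp d1.
rewrite compmN -fmap_comp in duv.
have dquv := (dist_rot _ _ _).2 duv.
(* The connecting morphism [W1 -> Z2[1]] factors through the shift of
   [A -> Z2], so it dies when composed with the shift of [Z2 -> W2]. *)
have vE : v = - (fmap (shift T) (p2 @; f) @; n1).
  rewrite -(comp1m v) -fmap1 -p22 fmap_comp -compA -[fmap _ i2 @; v]opprK -compNm lv.
  by rewrite compmN compA -fmap_comp.
have [P [m [n dP]]] := dist_ex (q @; i2 @; (p2 @; f)).
have [u' [v' [duv' _ _]]] := dist_octa d2 dquv dP.
have hv0 : fmap (shift T) m2 @; v = 0.
  by rewrite vE compmN compA -fmap_comp (dist_comp0 d2) fmap0 comp0m oppr0.
rewrite hv0 in duv'.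
exists W1, W2, P; split.
- by do 3!eexists; exact: d1.
- by do 3!eexists; exact: d2.
- by apply: triangle_rot; do 3!eexists; exact: dP.
have [r' [s' bP]] := dist_split duv'.
by apply: biproduct_sym; do 4!eexists; exact: bP.
Qed.

End Triangles.

(** * Euler characteristics along a silting subcategory *)

Section Filtrations.
Variable T : triangulatedCat.
Hypothesis hT : krull_schmidt T.
Variable M : set T.
Hypothesis hM : silting M.
Implicit Types (X Y Z W S N P O : T) (u v w : {freeg isoclass T}).

Let subM : is_subcategory M := silting_sub hM.

(** [filtered k l X v]: the object [X] is an iterated extension of objects
    [N_k[k]], ..., [N_(k+l)[k+l]] with [N_i] in [M], the lowest shift being the
    first subobject, and [v] is the alternating sum of the classes of the [N_i]. *)
Fixpoint filtered (k l : nat) X v : Prop :=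
  if l is l'.+1 then
    exists N w Y u, [/\ M N, split_class N w, triangle (sh k N) X Y,
      filtered k.+1 l' Y u & v = (-1) ^+ k *: w + u]
  else exists N w,
    [/\ M N, split_class N w, isomorphic (sh k N) X & v = (-1) ^+ k *: w].

Lemma filtered_iso k l X Y v : isomorphic X Y -> filtered k l X v -> filtered k l Y v.
Proof.
case: l => [|l] XY /=.
  by move=> [N [w [MN Nw NX ->]]]; exists N, w; split=> //; apply: isomorphic_trans XY.
move=> [N [w [Z [u [MN Nw tr Zu ->]]]]]; exists N, w, Z, u; split=> //.
by apply: triangle_iso tr => //; apply: isomorphic_refl.
Qed.

Lemma silting_iter_hom0 j k N N' : M N -> M N' -> (j < k)%N ->
  forall f : hom (sh j N) (sh k N'), f = 0.
Proof.
move=> MN MN' jk; rewrite -(subnKC (ltnW jk)) iterD; apply: iter_shift_hom0.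
by apply: silting_hom hM _ _ _ _ _ _; rewrite // subn_gt0.
Qed.

(** The vanishing of [hom N N'[i]] for [i > 0] propagates along filtrations; this
    is what splits the extensions met below. *)
Lemma filtered_hom0 j k l N X v : M N -> (j < k)%N -> filtered k l X v ->
  forall f : hom (sh j N) X, f = 0.
Proof.
move=> MN; elim: l k X v => [|l IHl] k X v jk /=.
  move=> [N' [w [MN' _ NX _]]]; apply: hom0_iso (isomorphic_refl _) NX _.
  exact: silting_iter_hom0.
move=> [N' [w [Y [u [MN' _ tr Yu _]]]]].
apply: triangle_hom0 tr _ _; first exact: silting_iter_hom0.
by apply: IHl Yu; apply: ltnW.
Qed.

Lemma filtered_shift k l X v : filtered k l X v -> filtered k.+1 l (shift T X) (- v).
Proof.
elim: l k X v => [|l IHl] k X v /=.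
  move=> [N [w [MN Nw NX ->]]]; exists N, w.
  split=> //; last by rewrite exprS mulN1r scaleNr.
  exact/shift_isomorphicP.
move=> [N [w [Y [u [MN Nw tr Yu ->]]]]].
exists N, w, (shift T Y), (- u); split=> //.
- exact: triangle_shift.
- exact: IHl.
- by rewrite exprS mulN1r scaleNr opprD.
Qed.

Lemma filtered_zero k l O : is_zero O -> filtered k l O 0.
Proof.
move=> O0; have MO := sub_zero subM O0.
elim: l k => [|l IHl] k /=; last first.
  exists O, 0, O, 0; split; rewrite ?scaler0 ?addr0 //; first exact: split_class_zero.
  apply: triangle_zero_r => //; apply: is_zero_isomorphic => //.
  exact: iter_shift_zero.
exists O, 0; rewrite scaler0; split=> //; first exact: split_class_zero.
by apply: is_zero_isomorphic => //; apply: iter_shift_zero.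
Qed.

Lemma filtered_weaken k l X v : filtered k l X v -> filtered k l.+1 X v.
Proof.
elim: l k X v => [|l IHl] k X v.
  move=> [N [w [MN Nw NX ->]]]; have [O O0] := zero_ex T.
  exists N, w, O, 0; rewrite addr0; split=> //; first exact: triangle_zero_r.
  exact: filtered_zero.
move=> [N [w [Y [u [MN Nw tr Yu ->]]]]].
by exists N, w, Y, u; split=> //; apply: IHl.
Qed.

Lemma filtered_addn m k l X v : filtered k l X v -> filtered k (m + l) X v.
Proof. by move=> Xv; elim: m => // m; apply: filtered_weaken. Qed.

Lemma filtered_lower k l X v : filtered k.+1 l X v -> filtered k l.+1 X v.
Proof.
move=> Xv; have [O O0] := zero_ex T.
exists O, 0, X, v; rewrite scaler0 add0r; split=> //.
- exact: sub_zero.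
- exact: split_class_zero.
- by apply: triangle_zero_l; [apply: iter_shift_zero|apply: isomorphic_refl].
Qed.

Lemma filtered_silting k l N w : M N -> split_class N w ->
  filtered k l (sh k N) ((-1) ^+ k *: w).
Proof.
move=> MN Nw; rewrite -[l]addn0; apply: filtered_addn.
by exists N, w; split=> //; apply: isomorphic_refl.
Qed.

(** Closure under extensions and additivity of the alternating sum, by the
    horseshoe lemma. *)
Lemma filtered_triangle k l X Y Z v w : filtered k l X v -> filtered k l Z w ->
  triangle X Y Z -> filtered k l Y (v + w).
Proof.
elim: l k X Y Z v w => [|l IHl] k X Y Z v w.
  move=> Xv [N' [w' [MN' Nw' NZ ->]]] tr.
  have ZX0 : forall f : hom Z (shift T X), f = 0.
    apply: hom0_iso NZ (isomorphic_refl _) _.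
    exact: filtered_hom0 MN' (ltnSn k) (filtered_shift Xv).
  have [N [v' [MN Nv' NX ->]]] := Xv.
  have [E NE] := biproduct_ex N N'.
  exists E, (v' + w'); split; last by rewrite scalerDr.
  - exact: sub_biproduct NE.
  - exact: split_class_biproduct NE.
  apply: biproduct_uniq (triangle_split tr ZX0).
  by apply: biproduct_congr NX NZ _; apply/iter_shift_biproductP.
move=> [A [a [X1 [v1 [MA Aa AX Xv ->]]]]] [B [b [Z1 [w1 [MB Bb BZ Zw ->]]]]] tr.
have [|C [Y1 [ACB CY tr1]]] := triangle_horseshoe tr AX BZ.
  by apply: filtered_hom0 MB _ (filtered_shift Xv); apply: ltnW.
have [E ABE] := biproduct_ex A B.
exists E, (a + b), Y1, (v1 + w1); split.
- exact: sub_biproduct ABE.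
- exact: split_class_biproduct ABE.
- apply: triangle_iso CY; try exact: isomorphic_refl.
  apply: biproduct_uniq ((iter_shift_biproductP k _ _ _).2 ABE).
  apply: triangle_split ACB _.
  exact: (@silting_iter_hom0 k k.+1).
- exact: IHl tr1.
- by rewrite scalerDr addrACA.
Qed.

(** Independence of the filtration: two filtrations of [X] start with morphisms
    from [A[k]] and [B[k]], and the object [P] of Schanuel's lemma inherits two
    filtrations of smaller length, which have the same alternating sum. *)
Lemma filtered_uniq k l X v w : filtered k l X v -> filtered k l X w -> v = w.
Proof.
elim: l k X v w => [|l IHl] k X v w /=.
  move=> [N [a [_ Na NX ->]]] [N' [b [_ N'b N'X ->]]]; congr (_ *: _).
  apply: split_class_uniq Na _; apply: split_class_iso N'b.
  apply/(iter_shift_isomorphicP k); apply: isomorphic_trans N'X _.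
  exact: isomorphic_sym.
move=> [A [a [Y [v1 [MA Aa AX Yv ->]]]]] [B [b [Z [w1 [MB Bb BX Zw ->]]]]].
have [P [YPB ZPA]] := triangle_schanuel AX BX.
have := filtered_triangle Yv (filtered_silting k.+1 l MB Bb) YPB.
move=> /IHl/(_ (filtered_triangle Zw (filtered_silting k.+1 l MA Aa) ZPA)).
rewrite exprS mulN1r !scaleNr => vwE.
rewrite -[v1](subrK ((-1) ^+ k *: b)) vwE addrA [_ + (w1 - _)]addrC subrK.
exact: addrC.
Qed.

(** Closure under direct summands: in the inductive step, the cone [W1] of
    [A[k] -> X] is a summand of an extension [P] of filtered objects. *)
Lemma filtered_summand k l X Y S v : biproduct X Y S -> filtered k l S v ->
  exists u, filtered k l X u.
Proof.
elim: l k X Y S v => [|l IHl] k X Y S v XYS /=.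
  move=> [N [w [MN _ NS _]]].
  have [A AX] := iter_shift_surj k X; have [B BY] := iter_shift_surj k Y.
  have ABN : biproduct A B N.
    apply/(iter_shift_biproductP k); apply: biproduct_iso (isomorphic_sym NS) _.
    by apply: biproduct_congr XYS; apply: isomorphic_sym.
  have MA := sub_biproduct_l subM ABN MN.
  have [a Aa] := split_class_ex hT A.
  by exists ((-1) ^+ k *: a), A, a.
move=> [A [a [Z [w [MA Aa tr Zw _]]]]].
have [W1 [W2 [P [tr1 _ ZPA W1P]]]] := triangle_summand tr XYS.
have Pw := filtered_triangle Zw (filtered_silting k.+1 l MA Aa) ZPA.
have [u W1u] := IHl _ _ _ _ _ W1P Pw.
by exists ((-1) ^+ k *: a + u), A, a, W1, u.
Qed.

Lemma signZK n v : (-1) ^+ n *: ((-1) ^+ n *: v) = v.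
Proof. by rewrite scalerA -expr2 sqrr_sign scale1r. Qed.

(** [euler X v]: the Euler characteristic of [X], computed after shifting [X] far
    enough to be an iterated extension of nonnegative shifts of objects of [M]. *)
Definition euler X v : Prop :=
  exists n l, filtered 0 l (sh n X) ((-1) ^+ n *: v).

Lemma filtered_shiftn n m l X v : filtered 0 l (sh n X) ((-1) ^+ n *: v) ->
  filtered 0 (m + l) (sh (m + n) X) ((-1) ^+ (m + n) *: v).
Proof.
move=> Xv; elim: m => // m IHm.
rewrite !addSn exprS mulN1r scaleNr; apply: filtered_lower.
exact: filtered_shift IHm.
Qed.

(** Any two Euler characteristics can be computed at a common shift and length. *)
Lemma euler_common X Y v w : euler X v -> euler Y w -> exists n l,
  filtered 0 l (sh n X) ((-1) ^+ n *: v) /\ filtered 0 l (sh n Y) ((-1) ^+ n *: w).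
Proof.
move=> [n [l Xv]] [m [l' Yw]]; exists (m + n)%N, ((m + l) + (n + l'))%N; split.
  by rewrite [(_ + (n + _))%N]addnC; apply/filtered_addn/filtered_shiftn.
by apply: filtered_addn; rewrite [(m + n)%N]addnC; apply: filtered_shiftn.
Qed.

Lemma euler_uniq X v w : euler X v -> euler X w -> v = w.
Proof.
move=> Xv Xw; have [n [l [/filtered_uniq Xv' /Xv']]] := euler_common Xv Xw.
exact: (can_inj (signZK n)).
Qed.

Lemma euler_iso X Y v : isomorphic X Y -> euler X v -> euler Y v.
Proof.
move=> XY [n [l Xv]]; exists n, l; apply: filtered_iso Xv.
exact/iter_shift_isomorphicP.
Qed.

Lemma triangle_shiftn n X Y Z : triangle X Y Z -> triangle (sh n X) (sh n Y) (sh n Z).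
Proof. by move=> tr; elim: n => // n; apply: triangle_shift. Qed.

Lemma euler_triangle X Y Z v w : triangle X Y Z -> euler X v -> euler Z w ->
  euler Y (v + w).
Proof.
move=> tr Xv Zw; have [n [l [Xv' Zw']]] := euler_common Xv Zw.
exists n, l; rewrite scalerDr; apply: filtered_triangle Xv' Zw' _.
exact: triangle_shiftn.
Qed.

Lemma euler_shift X v : euler X v -> euler (shift T X) (- v).
Proof.
move=> [n [l Xv]]; exists n, l.+1; rewrite -iterSr scalerN.
exact/filtered_lower/filtered_shift.
Qed.

Lemma euler_silting N w : M N -> split_class N w -> euler N w.
Proof. by move=> MN Nw; exists 0%N, 0%N; apply: filtered_silting. Qed.

(** The objects that have an Euler characteristic form a thick subcategory, hence
    are all the objects. *)
Lemma euler_thick : is_thick [set X | exists v, euler X v]%classic.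
Proof.
split=> [||X [v [n [l Xv]]]|X Y Z f g h fgh [v Xv] [w Yw]] /=.
- split=> /= [X Y XY [v Xv]|n X S|X S].
  + by exists v; apply: euler_iso Xv.
  + apply: (closed_coproduct (M := [set X | exists v, euler X v]%classic)) => /= {n X S}.
      by move=> O O0; exists 0, 0%N, 0%N; rewrite scaler0; apply: filtered_zero.
    move=> X Y S XYS [v Xv] [w Yw]; exists (v + w).
    exact: euler_triangle (triangle_biproduct XYS) Xv Yw.
  + move=> [Y /biproduct_coproduct2 XYS] [v [n [l Sv]]].
    have [u Xu] := filtered_summand ((iter_shift_biproductP n _ _ _).2 XYS) Sv.
    by exists ((-1) ^+ n *: u), n, l; rewrite signZK.
- by move=> X [v /euler_shift Xv]; exists (- v).
- exists (- v), n.+1, l; rewrite exprS mulN1r scaleNr scalerN opprK.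
  apply: filtered_iso Xv; rewrite iterSr; apply/iter_shift_isomorphicP.
  exact/isomorphic_sym/shift_unshift.
have /triangle_rot tr : triangle X Y Z by exists f, g, h.
by exists (w - v); apply: euler_triangle tr Yw (euler_shift Xv).
Qed.

Lemma euler_ex X : exists v, euler X v.
Proof.
have XM : thick M X by rewrite (silting_thick hM).
apply: (XM [set X | exists v, euler X v]%classic); split; first exact: euler_thick.
move=> N MN; have [w Nw] := split_class_ex hT N.
by exists w; apply: euler_silting.
Qed.

End Filtrations.

(** * Free abelian groups and the Grothendieck group *)

Section FreeGroups.
Variables I K : choiceType.

(** Extension of a map of generators to free abelian groups. *)
Definition freeg_lin (f : I -> {freeg K}) : {freeg I} -> {freeg K} := fglift f.

HB.instance Definition _ f := GRing.isZmodMorphism.Build {freeg I} {freeg K}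
  (freeg_lin f) (lift_is_additive f).

Lemma freeg_linUz f k i : freeg_lin f << k *g i >> = k *: f i.
Proof. exact: liftU. Qed.

Lemma freeg_linU f i : freeg_lin f << i >> = f i.
Proof. by rewrite -[RHS]scale1r; apply: freeg_linUz. Qed.

Lemma freeg_linE f (D : {freeg I}) :
  freeg_lin f D = \sum_(i <- dom D) f i *~ coeff i D.
Proof.
rewrite -{1}[D]freeg_sumE raddf_sum; apply: eq_bigr => i _.
transitivity (coeff i D *: f i); first exact: freeg_linUz.
by rewrite -{1}[coeff i D]intz scaler_int.
Qed.

Lemma coeff_freeg_lin (f : I -> K) i (D : {freeg I}) : injective f ->
  coeff (f i) (freeg_lin (fun j => << f j >>) D) = coeff i D.
Proof.
move=> finj; rewrite freeg_linE -[in RHS](freeg_sumE D) !raddf_sum /=.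
apply: eq_bigr => j _.
rewrite raddfMz coeffU -(inj_eq finj) -mulrzl intz.
congr (_ * _); exact: etrans (coeffU 1 (f j) (f i)) (mul1r _).
Qed.

End FreeGroups.

Section GrothendieckGroup.
Variable T : triangulatedCat.
Implicit Types (X Y Z O : T) (D : {freeg isoclass T}).

(** The class of an object in the Grothendieck group. *)
Definition K0_of X : K0 T := K0_class (iso_class X).

Lemma K0_of_iso X Y : isomorphic X Y -> K0_of X = K0_of Y.
Proof. by move=> /iso_classP XY; rewrite /K0_of XY. Qed.

Lemma K0_piP D E : \pi_(K0 T) D = \pi_(K0 T) E <-> D - E \in @K0_rel T.
Proof.
rewrite Quotient.idealrBE; split=> [/eqP//|/eqP//].
Qed.

Lemma K0_of_triangle X Y Z : triangle X Y Z -> K0_of Y = K0_of X + K0_of Z.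
Proof.
move=> [f [g [h fgh]]]; rewrite /K0_of /K0_class -raddfD; apply/K0_piP.
apply/asboolP => S _; apply; exists X, Y, Z, f, g, h; split=> //.
by rewrite opprD addrA.
Qed.

Lemma K0_of_zero O : is_zero O -> K0_of O = 0.
Proof.
move=> O0; apply: (addIr (K0_of O)); rewrite add0r; apply/esym/K0_of_triangle.
by apply: triangle_zero_r => //; apply: isomorphic_refl.
Qed.

Lemma K0_of_shift X : K0_of (shift T X) = - K0_of X.
Proof.
have [O O0] := zero_ex T; apply: (addrI (K0_of X)).
by rewrite -(K0_of_triangle (triangle_shift_cone X O0)) subrr K0_of_zero.
Qed.

(** An additive map on the free group that is additive on triangles vanishes on
    the relations of the Grothendieck group. *)
Lemma K0_rel_additive (A : zmodType) (F : {additive {freeg isoclass T} -> A}) :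
  (forall X Y Z, triangle X Y Z ->
    F << iso_class Y >> = F << iso_class X >> + F << iso_class Z >>) ->
  forall D, D \in @K0_rel T -> F D = 0.
Proof.
move=> FE D /asboolP/(_ [pred E | F E == 0]) FD; apply/eqP; apply: FD.
  split=> [|E E']; rewrite !inE ?raddf0 //.
  by move=> /eqP FE0 /eqP FE'0; rewrite raddfB FE0 FE'0 subrr.
move=> _ [X [Y [Z [f [g [h [fgh ->]]]]]]]; rewrite inE !raddfB.
rewrite (FE X Y Z); last by exists f, g, h.
by rewrite addrAC addrK subrr.
Qed.

End GrothendieckGroup.

(** * The basis of the Grothendieck group *)

Section SiltingBasis.
Variable T : triangulatedCat.
Hypothesis hT : krull_schmidt T.
Variable M : set T.
Hypothesis hM : silting M.
Implicit Types (X Y Z N : T).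

Let subM : is_subcategory M := silting_sub hM.

(** The inclusion of the free group on [ind M] into that on all isomorphism
    classes. *)
Definition ind_emb : {freeg (ind M)} -> {freeg isoclass T} :=
  freeg_lin (fun c : ind M => << val c >>).

HB.instance Definition _ := GRing.Additive.on ind_emb.

Lemma ind_emb_inj : injective ind_emb.
Proof.
move=> D E DE; apply/eqP/freeg_eqP => c.
by rewrite -!(coeff_freeg_lin _ _ val_inj) -/(ind_emb _) DE.
Qed.

Lemma ind_combE (D : {freeg (ind M)}) :
  \sum_(c <- dom D) K0_class (val c) *~ coeff c D = \pi_(K0 T) (ind_emb D).
Proof.
rewrite /ind_emb freeg_linE raddf_sum; apply: eq_bigr => c _.
by rewrite raddfMz.
Qed.

(** The subgroup of the Grothendieck group generated by the classes of [ind M]. *)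
Definition ind_span (x : K0 T) : Prop := exists D, x = \pi_(K0 T) (ind_emb D).

Lemma ind_spanD x y : ind_span x -> ind_span y -> ind_span (x + y).
Proof. by move=> [D ->] [E ->]; exists (D + E); rewrite !raddfD. Qed.

Lemma ind_spanN x : ind_span x -> ind_span (- x).
Proof. by move=> [D ->]; exists (- D); rewrite !raddfN. Qed.

Lemma ind_span0 : ind_span 0.
Proof. by exists 0; rewrite !raddf0. Qed.

Lemma ind_span_local L : M L -> is_local L -> ind_span (K0_of L).
Proof.
move=> ML locL.
have indL : ind M (iso_class L).
  by exists L => //; split=> //; apply: local_indecomposable.
exists << (SigSub (mem_set indL) : ind M) >>.
by rewrite /ind_emb freeg_linU.
Qed.

Lemma ind_span_silting N : M N -> ind_span (K0_of N).
Proof.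
have [s ds] := krull_schmidt_decomposes hT N.
elim: s N ds => [|L s IHs] N.
  by move=> /decomposes_nilP N0 _; rewrite K0_of_zero //; apply: ind_span0.
move=> /decomposes_consP[N' [locL ds bp]] MN.
rewrite (K0_of_triangle (triangle_biproduct bp)); apply: ind_spanD.
  by apply: ind_span_local => //; apply: sub_biproduct_l bp MN.
by apply: IHs => //; apply: sub_biproduct_l (biproduct_sym bp) MN.
Qed.

Lemma ind_span_shiftn n X : ind_span (K0_of (iter n (shift T) X)) <-> ind_span (K0_of X).
Proof.
elim: n => //= n IHn; rewrite K0_of_shift -IHn.
by split=> /ind_spanN //; rewrite opprK.
Qed.

Lemma ind_span_filtered k l X v : filtered M k l X v -> ind_span (K0_of X).
Proof.
elim: l k X v => [|l IHl] k X v /=.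
  move=> [N [_ [MN _ /K0_of_iso <- _]]].
  exact/ind_span_shiftn/ind_span_silting.
move=> [N [_ [Y [u [MN _ tr Yu _]]]]]; rewrite (K0_of_triangle tr).
by apply: ind_spanD; [exact/ind_span_shiftn/ind_span_silting|exact: IHl Yu].
Qed.

Lemma ind_span_of X : ind_span (K0_of X).
Proof.
have [v [n [l Xv]]] := euler_ex hT hM X.
exact/ind_span_shiftn/(ind_span_filtered Xv).
Qed.

Lemma ind_spanMz x (z : int) : ind_span x -> ind_span (x *~ z).
Proof. by move=> [D ->]; exists (D *~ z); rewrite !raddfMz. Qed.

Lemma ind_span_full x : ind_span x.
Proof.
elim/quotW: x => E; rewrite -[E]freeg_sumE raddf_sum.
apply: big_ind => [||c _]; [exact: ind_span0|exact: ind_spanD|].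
rewrite -[coeff c E]intz -freegU_mulz raddfMz; apply: ind_spanMz.
by have := ind_span_of (repr c); rewrite /K0_of /iso_class reprK.
Qed.

(** The Euler characteristic of objects descends to a left inverse of the map
    from the free abelian group on [ind M] to the Grothendieck group. *)
Lemma ind_emb_pi_inj D E :
  \pi_(K0 T) (ind_emb D) = \pi_(K0 T) (ind_emb E) -> D = E.
Proof.
have [chi chiP] := choice (fun c : isoclass T => euler_ex hT hM (repr c)).
have chiE X v : euler M X v -> chi (iso_class X) = v.
  apply: (euler_uniq hM (X := X)); apply: euler_iso (chiP _).
  by apply/iso_classP; rewrite /iso_class reprK.
have chi_emb D' : freeg_lin chi (ind_emb D') = ind_emb D'.
  rewrite /ind_emb [X in freeg_lin chi X]freeg_linE raddf_sum freeg_linE.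
  apply: eq_bigr => c _; rewrite raddfMz /= freeg_linU; congr (_ *~ _).
  have [N [MN indN] <-] := set_valP c.
  by apply/chiE/(euler_silting hM MN)/split_class_indecomposable.
move=> /K0_piP/(K0_rel_additive (F := freeg_lin chi)) DE.
apply/ind_emb_inj/eqP; rewrite -subr_eq0 -[ind_emb D]chi_emb -[ind_emb E]chi_emb.
rewrite -raddfB DE // => X Y Z tr; rewrite /= !freeg_linU.
have [v Xv] := euler_ex hT hM X; have [w Zw] := euler_ex hT hM Z.
by rewrite (chiE _ _ Xv) (chiE _ _ Zw); apply/chiE/(euler_triangle hM tr).
Qed.

End SiltingBasis.

Theorem theorem2p27 (T : triangulatedCat) (M : set T)
    (hT : krull_schmidt T) (hM : silting M) :
  zbasis (fun c : ind M => K0_class (val c)).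
Proof.
move=> v; have [D vE] := ind_span_full hT hM v.
exists D; split; first by rewrite ind_combE.
move=> E; rewrite ind_combE vE; exact: (ind_emb_pi_inj hT hM).
Qed.
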